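(* Every right quasigroup $Q$ is realizable by an edgeless graph, by a complete graph, and by a complete digraph.
   Context: A right quasigroup $V_R$ is a pair $(V,R)$ where $V$ is a set and $R:V\to S_V$, $v\mapsto R_v$, is a function to the group of permutations of $V$. A homomorphism $V_R\to W_T$ is a function $\varphi:V\to W$ with $\varphi R_v=T_{\varphi(v)}\varphi$ for all $v\in V$; isomorphism is meant in this sense. A digraph is a pair $(V,E)$ with $E\subseteq V\times V$. A graph is a simple undirected graph: $E$ is a set of unordered pairs $\{v,w\}\subseteq V$ with $v\neq w$. No finiteness is assumed. An automorphism of a (di)graph is a permutation of $V$ sending edges to edges, and $\operatorname{Aut}\Gamma$ is the set of automorphisms of $\Gamma$. A marking of a (di)graph $\Gamma$ with vertex set $V$ is a function $R:V\to\operatorname{Aut}\Gamma$, and $V_R^\Gamma:=(V,R)$ is the right quasigroup realized by $(\Gamma,R)$. A right quasigroup $Q$ is realizable by $\Gamma$ if there is a marking $R$ of $\Gamma$ with $Q\cong V_R^\Gamma$. A digraph $(V,E)$ is complete if $E=\{(v,w)\in V\times V\mid v\ne w\}$; a graph is complete if $E$ consists of all unordered pairs of distinct vertices; a graph is edgeless if $E=\emptyset$. *)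

(* Defs.v *)
(* Vertex types may be infinite, so {perm T} and {set T}, which need a finType,
   do not apply. *)
From mathcomp Require Import all_boot.
From mathcomp Require Import classical_sets.
Set Implicit Arguments.
Unset Strict Implicit.
Unset Printing Implicit Defensive.
Local Open Scope classical_set_scope.

Record permutation (V : Type) := Permutation {
  perm_fun :> V -> V;
  perm_bij : bijective perm_fun
}.

Record right_quasigroup := RightQuasigroup {
  rq_carrier :> Type;
  rq_perm : rq_carrier -> permutation rq_carrier
}.

Definition rq_hom (Q Q' : right_quasigroup) (phi : Q -> Q') : Prop :=
  forall v : Q, phi \o rq_perm v =1 rq_perm (phi v) \o phi.

Definition rq_isomorphic (Q Q' : right_quasigroup) : Prop :=
  exists (phi : Q -> Q') (psi : Q' -> Q),
    [/\ rq_hom phi, rq_hom psi, cancel phi psi & cancel psi phi].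

Record digraph := Digraph {
  dvertex :> Type;
  dedges : set (dvertex * dvertex)
}.

Definition unordered_pairs (V : Type) : set (set V) :=
  [set e | exists v w : V, v <> w /\ e = [set v; w]].

Record graph := Graph {
  gvertex :> Type;
  gedges : set (set gvertex);
  gedgesP : gedges `<=` @unordered_pairs gvertex
}.

(* Edges are only required to be sent to edges; on an infinite (di)graph this
   does not force non-edges to be sent to non-edges. *)
Record dautomorphism (G : digraph) := DAutomorphism {
  daut_perm :> permutation G;
  daut_edges : forall v w : G,
    dedges (v, w) -> dedges (daut_perm v, daut_perm w)
}.

Record gautomorphism (G : graph) := GAutomorphism {
  gaut_perm :> permutation G;
  gaut_edges : forall e : set G, gedges e -> gedges (gaut_perm @` e)
}.

Definition dmarking (G : digraph) := G -> dautomorphism G.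
Definition gmarking (G : graph) := G -> gautomorphism G.

Definition drealized (G : digraph) (R : dmarking G) : right_quasigroup :=
  RightQuasigroup (fun v : G => daut_perm (R v)).
Definition grealized (G : graph) (R : gmarking G) : right_quasigroup :=
  RightQuasigroup (fun v : G => gaut_perm (R v)).

Definition drealizable (Q : right_quasigroup) (G : digraph) : Prop :=
  exists R : dmarking G, rq_isomorphic Q (drealized R).
Definition grealizable (Q : right_quasigroup) (G : graph) : Prop :=
  exists R : gmarking G, rq_isomorphic Q (grealized R).

Definition complete_digraph (G : digraph) : Prop :=
  @dedges G = [set p | p.1 <> p.2].
Definition complete_graph (G : graph) : Prop :=
  @gedges G = @unordered_pairs G.
Definition edgeless_graph (G : graph) : Prop :=
  @gedges G = set0.

(* Main.v *)
(* On a graph (or digraph) that is edgeless or complete, every permutation of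
   the vertices is an automorphism, so the right quasigroup structure of Q is
   itself a marking, and the identity map is the required isomorphism. *)
From mathcomp Require Import all_boot.
From mathcomp Require Import classical_sets.
Require Import Defs.
Set Implicit Arguments.
Unset Strict Implicit.
Unset Printing Implicit Defensive.
Local Open Scope classical_set_scope.

Lemma rq_isomorphic_refl (Q : right_quasigroup) : rq_isomorphic Q Q.
Proof. by exists id, id. Qed.

(** Serves the edgeless and the complete graph alike: stability of [E] makes each [rq_perm v] an
    automorphism. *)
Lemma grealizable_perm_invariant (Q : right_quasigroup) (E : set (set Q))
    (EP : E `<=` @unordered_pairs Q) :
  (forall (s : permutation Q) e, E e -> E (s @` e)) ->
  grealizable Q (Graph EP).
Proof.
move=> sE.
exists (fun v => @GAutomorphism (Graph EP) (rq_perm v) (sE (rq_perm v))).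
(* Once [Q] is destructed, the realized right quasigroup is convertible to it, so reflexivity
   applies. *)
by case: Q E EP sE => V r E EP sE; exact: rq_isomorphic_refl.
Qed.

Lemma drealizable_perm_invariant (Q : right_quasigroup) (E : set (Q * Q)) :
  (forall (s : permutation Q) v w, E (v, w) -> E (s v, s w)) ->
  drealizable Q (Digraph E).
Proof.
move=> sE.
exists (fun v => @DAutomorphism (Digraph E) (rq_perm v) (sE (rq_perm v))).
by case: Q E sE => V r E sE; exact: rq_isomorphic_refl.
Qed.

(** Injectivity keeps the two endpoints of a pair distinct. *)
Lemma unordered_pairs_image (V W : Type) (f : V -> W) (e : set V) :
  injective f -> unordered_pairs e -> unordered_pairs (f @` e).
Proof.
move=> f_inj [v [w [vw ->]]]; exists (f v), (f w); split; first by move/f_inj.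
by rewrite image_setU !image_set1.
Qed.

Theorem proposition1p4 (Q : right_quasigroup) :
  (exists G : graph, edgeless_graph G /\ grealizable Q G) /\
  (exists G : graph, complete_graph G /\ grealizable Q G) /\
  (exists G : digraph, complete_digraph G /\ drealizable Q G).
Proof.
split; [|split].
(* For [set0] the stability condition is vacuous. *)
- exists (Graph (@sub0set _ (@unordered_pairs Q))); split=> //.
  exact: grealizable_perm_invariant.
- exists (Graph (@subset_refl _ (@unordered_pairs Q))); split=> //.
  apply: grealizable_perm_invariant => s e.
  exact/unordered_pairs_image/bij_inj/perm_bij.
- exists (Digraph [set p : Q * Q | p.1 <> p.2]); split=> //.
  (* An equality [s v = s w] would force [v = w], against [vw]. *)
  apply: drealizable_perm_invariant => s v w /= vw /(bij_inj (perm_bij s)).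
  exact: vw.
Qed.
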